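(* Let $2\le\ell\le r$. Let $f:\mathbb{T}^{2}\rightarrow\mathbb{T}^{2}$ be an Anosov conservative $C^r$ diffeomorphism, let $\gamma\in C^r(\mathbb{T}^{2};\mathbb{S}^1)$ be a coboundary with respect to $f$ with $C^\ell$ transfer map, and let $F:\mathbb{T}^{2}\times\mathbb{S}^1\rightarrow\mathbb{T}^{2}\times\mathbb{S}^1$ be the skew-product $F(p,t)=(f(p),t+\gamma(p))$. Then $F$ is not a partially hyperbolic contact $C^r$ diffeomorphism; that is, there are no partially hyperbolic contact $C^r$ skew-products of this form.
   Context: $\mathbb{S}^1=\mathbb{R}/\mathbb{Z}$, written additively. ''Conservative'' means area-preserving (with respect to an area form on $\mathbb{T}^2$). Coboundary: $\gamma$ is a coboundary with respect to $f$ with transfer map $\mu:\mathbb{T}^2\to\mathbb{S}^1$ if $\gamma=\mu\circ f-\mu$. Partially hyperbolic: a diffeomorphism $F:N\to N$ is partially hyperbolic if there is a splitting $TN=E^s\oplus E^c\oplus E^u$ such that (i) $DF(E^\delta)=E^\delta$ for $\delta=s,c,u$; (ii) there are constants $C>0$ and $0<\lambda<1$ with $\|DF^n_p v_s\|\le C\lambda^n\|v_s\|$ and $\|DF_p^{-n}v_u\|\le C\lambda^n\|v_u\|$ for all $p\in N$, $v_s\in E^s_p$, $v_u\in E^u_p$ (and $n\ge 0$); (iii) there are real numbers $0<\mu_1<1<\mu_2$ (possibly depending on $p$) with $\|DF_p|_{E^s_p}\|<\mu_1<\|DF_p|_{E^c_p}\|<\mu_2<\|DF_p|_{E^u_p}\|$.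 Contact form on a $3$-manifold $N$: a globally defined differential $1$-form $\alpha$ with $\alpha\wedge d\alpha\neq 0$ at every point. Partially hyperbolic contact $C^r$ diffeomorphism: a partially hyperbolic $C^r$ diffeomorphism $F:N\to N$ for which there are a contact form $\alpha$ on $N$ and a $C^\infty$ function $\tau:N\to(0,+\infty)$ with $F^\ast\alpha=\tau\alpha$. *)

(* Defs.v *)
From HB Require Import structures.
From mathcomp Require Import all_boot all_order all_algebra.
From mathcomp Require Import lra.
From mathcomp Require Import generic_quotient ring_quotient.
From mathcomp Require Import all_classical all_reals all_analysis.

Set Implicit Arguments.
Unset Strict Implicit.
Unset Printing Implicit Defensive.

Import Order.TTheory GRing.Theory Num.Theory numFieldNormedType.Exports.

Local Open Scope classical_set_scope.
Local Open Scope ring_scope.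

(** * Tori as smooth manifolds *)

(* An abelian Lie group M given by its translation charts.  The chart centred
   at q is v |-> q + lie_exp v; its inverse is q' |-> lie_log (q' - q) near q.
   It trivialises the tangent bundle: T_q M is identified with [tangent M]. *)
Record lieGroup (R : realType) := LieGroup {
  points :> zmodType;
  tangent : normedModType R;
  lie_exp : tangent -> points;
  lie_log : points -> tangent;
  lie_expD : {morph lie_exp : u v / u + v};
  lie_logK : cancel lie_log lie_exp;
  lie_expK : \forall v \near (0 : tangent), lie_log (lie_exp v) = v }.

Section Circle.
Variable R : realType.

Definition integers : {pred R} := [pred x | x \is a Num.int].

Fact integers_zmod_closed : zmod_closed integers.
Proof.
by split=> [|x y]; rewrite !inE; [exact: rpred0 | exact: rpredB].
Qed.

HB.instance Definition _ :=
  GRing.isZmodClosed.Build R integers integers_zmod_closed.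

Definition circle_points : zmodType := Quotient.quot integers.

Definition circle_exp (x : R^o) : circle_points :=
  \pi_(Quotient.quot integers)%qT (x : R).

(* values in [-1/2, 1/2[, hence smooth near the neutral element *)
Definition circle_log (q : circle_points) : R^o :=
  let x : R := repr q in x - (Num.floor (x + 2^-1))%:~R.

Fact circle_expD : {morph circle_exp : u v / u + v}.
Proof. by move=> u v; rewrite /circle_exp !piE. Qed.

Fact circle_logK : cancel circle_log circle_exp.
Proof.
move=> q; rewrite -[RHS]reprK; apply/eqP.
by rewrite -Quotient.idealrBE inE addrAC subrr sub0r rpredN intr_int.
Qed.

Fact circle_expK : \forall v \near (0 : R^o), circle_log (circle_exp v) = v.
Proof.
have half_gt0 : 0 < (2^-1 : R) by rewrite invr_gt0.
near=> v.
rewrite /circle_log; set x : R := repr _.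
have /intrP[m xvE] : x - v \is a Num.int.
  have : (x == v %[mod Quotient.quot integers])%qT by rewrite reprK.
  by rewrite -Quotient.idealrBE inE.
have -> : x = v + m%:~R by rewrite -xvE addrC subrK.
suff -> : Num.floor (v + m%:~R + 2^-1 : R) = m by rewrite addrK.
have : `|v : R| < 2^-1.
  by near: v; exact: (@nbhs0_lt R R^o _ half_gt0).
rewrite ltr_norml => /andP[v1 v2]; apply: floor_def; rewrite intrD.
by apply/andP; split; lra.
Unshelve. all: by end_near. Qed.

Definition circle : lieGroup R := LieGroup circle_expD circle_logK circle_expK.

End Circle.

Section Products.
Variables (R : realType) (M N : lieGroup R).

Definition prod_exp (v : tangent M * tangent N) : (M * N)%type :=
  (lie_exp v.1, lie_exp v.2).

Definition prod_log (q : (M * N)%type) : tangent M * tangent N :=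
  (lie_log q.1, lie_log q.2).

Fact prod_expD : {morph prod_exp : u v / u + v}.
Proof. by move=> u v; rewrite /prod_exp !lie_expD. Qed.

Fact prod_logK : cancel prod_log prod_exp.
Proof. by move=> [p q]; rewrite /prod_exp !lie_logK. Qed.

Fact prod_expK :
  \forall v \near (0 : tangent M * tangent N), prod_log (prod_exp v) = v.
Proof.
exists ([set v | lie_log (lie_exp v) = v], [set v | lie_log (lie_exp v) = v]).
  by split; exact: lie_expK.
by move=> [u v] [/= uE vE]; rewrite /prod_log /= uE vE.
Qed.

Definition prod_lie : lieGroup R := LieGroup prod_expD prod_logK prod_expK.

End Products.

Section Vectors.
Variables (R : realType) (V : normedModType R).

Fact vector_expD : {morph (@id V) : u v / u + v}.
Proof. by []. Qed.

Fact vector_expK : \forall v \near (0 : V), id (id v) = v.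
Proof. exact: nearW. Qed.

Definition vector_lie : lieGroup R :=
  @LieGroup R V V id id vector_expD (fun=> erefl) vector_expK.

End Vectors.

Definition torus2 (R : realType) : lieGroup R := prod_lie (circle R) (circle R).

(** * Differential calculus *)

(* g read in the charts centred at q and g q *)
Definition local_expr (R : realType) (M N : lieGroup R) (g : M -> N) (q : M)
    (v : tangent M) : tangent N :=
  lie_log (g (q + lie_exp v) - g q).

Definition tdiff (R : realType) (M N : lieGroup R) (g : M -> N) (q : M)
    : tangent M -> tangent N :=
  'd (local_expr g q) (0 : tangent M).

Definition tdifferentiable (R : realType) (M N : lieGroup R) (g : M -> N) :=
  forall q, differentiable (local_expr g q) (0 : tangent M).

Fixpoint class_Cn (R : realType) (k : nat) (M N : lieGroup R) (g : M -> N)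
    : Prop :=
  match k with
  | 0 => forall q, {for (0 : tangent M), continuous (local_expr g q)}
  | k'.+1 => tdifferentiable g /\
      forall v, class_Cn k' (N := vector_lie (tangent N)) (fun q => tdiff g q v)
  end.

(* A regularity is a natural number, or None for infinity. *)
Definition regularity := option nat.

Definition reg_le (l r : regularity) : bool :=
  match l, r with
  | _, None => true
  | None, Some _ => false
  | Some l', Some r' => (l' <= r')%N
  end.

Definition class_C (R : realType) (r : regularity) (M N : lieGroup R)
    (g : M -> N) : Prop :=
  if r is Some k then class_Cn k g else forall k, class_Cn k g.

Definition smooth_fun (R : realType) (M : lieGroup R) (h : M -> R) : Prop :=
  class_C None (N := vector_lie R^o) h.

Definition inverse_diffeos (R : realType) (r : regularity) (M : lieGroup R)
    (f finv : M -> M) : Prop :=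
  [/\ cancel f finv, cancel finv f, class_C r f & class_C r finv].

(** * Riemannian metrics and differential forms *)

Definition riemannian (R : realType) (M : lieGroup R)
    (g : M -> tangent M -> tangent M -> R) : Prop :=
  [/\ forall q u, linear (g q u : tangent M -> R^o),
      forall q u v, g q u v = g q v u,
      forall q v, v != 0 -> 0 < g q v v &
      forall u v, smooth_fun (fun q => g q u v)].

Definition metric_norm (R : realType) (M : lieGroup R)
    (g : M -> tangent M -> tangent M -> R) (q : M) (v : tangent M) : R :=
  Num.sqrt (g q v v).

Definition one_form (R : realType) (M : lieGroup R) (a : M -> tangent M -> R) :=
  (forall q, linear (a q : tangent M -> R^o)) /\
  (forall v, smooth_fun (fun q => a q v)).

(* d a (u, v) = u (a v) - v (a u) for the translation-invariant, hence
   commuting, vector fields u and v *)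
Definition ext_deriv (R : realType) (M : lieGroup R) (a : M -> tangent M -> R)
    (q : M) (u v : tangent M) : R :=
  tdiff (N := vector_lie R^o) (fun p => a p v) q u -
  tdiff (N := vector_lie R^o) (fun p => a p u) q v.

(* the 3-form a /\ d a *)
Definition wedge_ext_deriv (R : realType) (M : lieGroup R)
    (a : M -> tangent M -> R) (q : M) (u v w : tangent M) : R :=
  a q u * ext_deriv a q v w + a q v * ext_deriv a q w u
  + a q w * ext_deriv a q u v.

Definition contact_form (R : realType) (M : lieGroup R)
    (a : M -> tangent M -> R) : Prop :=
  one_form a /\ forall q, exists u v w, wedge_ext_deriv a q u v w != 0.

Definition area_form (R : realType) (w : torus2 R ->
    tangent (torus2 R) -> tangent (torus2 R) -> R) : Prop :=
  [/\ forall q u, linear (w q u : tangent (torus2 R) -> R^o),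
      forall q u v, w q u v = - w q v u,
      forall q, exists u v, w q u v != 0 &
      forall u v, smooth_fun (fun q => w q u v)].

(* f preserves the area |w|; it is allowed to reverse the orientation. *)
Definition conservative (R : realType) (f : torus2 R -> torus2 R) : Prop :=
  exists2 w, area_form w & forall q u v,
    `|w (f q) (tdiff f q u) (tdiff f q v)| = `|w q u v|.

(** * Hyperbolicity *)

Definition subspace_field (R : realType) (M : lieGroup R)
    (E : M -> set (tangent M)) : Prop :=
  forall q, submod_closed (mem (E q)).

Definition invariant_field (R : realType) (M : lieGroup R) (f : M -> M)
    (E : M -> set (tangent M)) : Prop :=
  forall q, tdiff f q @` E q = E (f q).

Definition contracted (R : realType) (M : lieGroup R)
    (g : M -> tangent M -> tangent M -> R) (f : M -> M)
    (E : M -> set (tangent M)) (C lambda : R) : Prop :=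
  forall n q v, E q v ->
    metric_norm g (iter n f q) (tdiff (iter n f) q v)
      <= C * lambda ^+ n * metric_norm g q v.

Definition anosov (R : realType) (r : regularity) (M : lieGroup R)
    (f : M -> M) : Prop :=
  exists2 finv, inverse_diffeos r f finv &
  exists2 g, riemannian g &
  exists Es Eu : M -> set (tangent M),
  [/\ subspace_field Es /\ subspace_field Eu,
      forall q v, exists! w : tangent M * tangent M,
        [/\ Es q w.1, Eu q w.2 & v = w.1 + w.2],
      invariant_field f Es /\ invariant_field f Eu &
      exists C lambda, [/\ 0 < C, 0 < lambda < 1,
        contracted g f Es C lambda & contracted g finv Eu C lambda]].

(* the operator norm of Df_q restricted to E q *)
Definition restr_norm (R : realType) (M : lieGroup R)
    (g : M -> tangent M -> tangent M -> R) (f : M -> M)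
    (E : M -> set (tangent M)) (q : M) : R :=
  sup [set metric_norm g (f q) (tdiff f q v)
      | v in [set v | E q v /\ metric_norm g q v <= 1]].

Definition partially_hyperbolic (R : realType) (r : regularity)
    (M : lieGroup R) (f : M -> M) : Prop :=
  exists2 finv, inverse_diffeos r f finv &
  exists2 g, riemannian g &
  exists Es Ec Eu : M -> set (tangent M),
  [/\ [/\ subspace_field Es, subspace_field Ec & subspace_field Eu],
      forall q v, exists! w : tangent M * tangent M * tangent M,
        [/\ Es q w.1.1, Ec q w.1.2, Eu q w.2 & v = w.1.1 + w.1.2 + w.2],
      [/\ invariant_field f Es, invariant_field f Ec & invariant_field f Eu],
      exists C lambda, [/\ 0 < C, 0 < lambda < 1,
        contracted g f Es C lambda & contracted g finv Eu C lambda] &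
      forall q, exists mu1 mu2, [/\ 0 < mu1 < 1, 1 < mu2,
        restr_norm g f Es q < mu1,
        mu1 < restr_norm g f Ec q < mu2 & mu2 < restr_norm g f Eu q]].

Definition partially_hyperbolic_contact (R : realType) (r : regularity)
    (M : lieGroup R) (F : M -> M) : Prop :=
  partially_hyperbolic r F /\
  exists2 a, contact_form a &
  exists tau : M -> R, [/\ smooth_fun tau, forall q, 0 < tau q &
    forall q v, a (F q) (tdiff F q v) = tau q * a q v].

(** * Skew-products *)

Definition coboundary (R : realType) (l : regularity) (M : lieGroup R)
    (f : M -> M) (gamma : M -> circle R) : Prop :=
  exists2 mu : M -> circle R, class_C l mu &
    forall p, gamma p = mu (f p) - mu p.

Definition skew_product (R : realType) (M : lieGroup R) (f : M -> M)
    (gamma : M -> circle R) (z : prod_lie M (circle R)) : prod_lie M (circle R) :=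
  (f z.1, z.2 + gamma z.1).

(* Main.v *)
(* The diffeomorphism F preserves the graphs S_t : p |-> (p, t + mu p) and acts
   on them as f.  Put beta(v) = alpha (D S_t v), W = (alpha /\ d alpha)(e1, e2, e3)
   and let omega be the area density.  Pulling back alpha /\ d alpha gives
   W(F) det Df = tau^2 W, and |omega(f) det Df| = |omega|, so tau cancels and
   beta^2 |omega| / |W| is invariant under Df.  By compactness it is bounded by a
   multiple of the squared norm of v, so letting the stable direction contract
   under f and the unstable one under f^-1, it vanishes on both.  Hence alpha
   kills the tangent spaces of the graphs: alpha = b (dt - d mu), and
   alpha /\ d alpha = 0. *)

Require Import Defs.
From mathcomp Require Import all_boot all_order all_algebra.
From mathcomp Require Import ring lra.
From mathcomp Require Import all_classical all_reals all_analysis.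

Set Implicit Arguments.
Unset Strict Implicit.
Unset Printing Implicit Defensive.

Import Order.TTheory GRing.Theory Num.Theory numFieldNormedType.Exports.

Local Open Scope classical_set_scope.
Local Open Scope ring_scope.

Local Notation is_tdiff phi q d :=
  (is_diff 0%R (@local_expr _ _ (vector_lie (_ : realType)^o) phi q) d).
Local Notation differentiable_fun phi :=
  (@tdifferentiable _ _ (vector_lie (_ : realType)^o) phi).
Local Notation fdiff phi := (@tdiff _ _ (vector_lie (_ : realType)^o) phi).

(** * Symmetry of second derivatives *)

Section Calculus.
Context {R : realType}.

(** [lie_log] inverts [lie_exp] only near 0, so some identities between local expressions hold only
    as germs; this transports differentials along them. *)
Lemma near_eq_is_diff (V W : normedModType R) (f g : V -> W) (x : V)
    (df : V -> W) :
  (\forall y \near x, f y = g y) -> is_diff x f df -> is_diff x g df.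
Proof.
move=> fg [dfx <-].
have gE : g \o shift x = cst (g x) + 'd f x +o_ 0 id.
  have /eqaddoP fo := diff_locally dfx.
  apply/eqaddoP => e e0; have := fo _ e0.
  have fg0 : \forall h \near (0 : V), f (h + x) = g (h + x).
    by move: fg; rewrite (near_shift 0 x) subr0.
  apply: filterS2 fg0 => h /= fgh.
  by rewrite !fctE /= -fgh -(nbhs_singleton fg).
have dgx := diff_unique (@diff_continuous _ _ _ _ _ dfx) gE.
apply: DiffDef => //.
by apply/diff_locallyP; rewrite dgx; split=> //; exact: diff_continuous.
Qed.

Lemma differentiable_expansion (V W : normedModType R) (f : V -> W) (x : V)
    (e : R) : differentiable f x -> 0 < e ->
  \forall h \near (0 : V), `|f (h + x) - f x - 'd f x h| <= e * `|h|.
Proof.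
move=> dfx e0; have /eqaddoP/(_ _ e0) := diff_locally dfx.
by apply: filterS => h /=; rewrite !fctE /= opprD addrA.
Qed.

Lemma is_diff_linear_comp (U V W : normedModType R) (l : {linear V -> W})
    (f df : U -> V) (x : U) :
  continuous l -> is_diff x f df -> is_diff x (l \o f) (l \o df).
Proof.
move=> cl h; apply: is_diff_comp.
by apply: DiffDef; [exact: linear_differentiable|rewrite diff_lin].
Qed.

(* By the mean value theorem applied to s |-> phi (s u + h v) - phi (s u). *)
Lemma second_difference (V : normedModType R) (phi : V -> R^o) (u v : V)
    (e : R) :
  (\forall x \near (0 : V), differentiable phi x) ->
  differentiable (fun x => 'd phi x u : R^o) (0 : V) -> 0 < e ->
  \forall h \near 0^'+,
   `|phi (h *: u + h *: v) - phi (h *: v) - (phi (h *: u) - phi 0)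
      - h ^+ 2 * 'd (fun x => 'd phi x u : R^o) (0 : V) v|
    <= e * (h ^+ 2 * (2 * `|u| + `|v|)).
Proof.
set D := fun x => 'd phi x u : R^o; set L := 'd D (0 : V).
move=> dphi dD e0; set K := `|u| + `|v|.
have [r /= r0 rP] : exists2 r : R, 0 < r & forall x : V, `|x| < r ->
    differentiable phi x /\ `|D x - D 0 - L x| <= e * `|x|.
  have /nbhs_norm0P[r /= r0 rP] : \forall x \near (0 : V),
      differentiable phi x /\ `|D x - D 0 - L x| <= e * `|x|.
    have dDe := differentiable_expansion dD e0.
    by apply: filterS2 dphi dDe => x dx; rewrite addr0.
  by exists r.
have K0 : 0 <= K by rewrite addr_ge0.
near=> h.
have h0 : 0 < h by near: h; exact: nbhs_right_gt.
have hK : h * K < r.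
  (* [K] may vanish, hence the [+ 1]. The bound keeps the parallelogram spanned by [h *: u] and
     [h *: v] inside the ball of radius [r]. *)
  have : h < r / (K + 1).
    by near: h; apply: nbhs_right_lt; rewrite divr_gt0 ?ltr_wpDl.
  rewrite ltr_pdivlMr ?ltr_wpDl// => /(le_lt_trans _); apply.
  by rewrite ler_pM2l// lerDl.
have small s c : 0 <= s <= h -> 0 <= c <= h ->
    `|s *: u + c *: v| <= s * `|u| + c * `|v|.
  move=> /andP[s0 _] /andP[c0 _]; apply: (le_trans (ler_normD _ _)).
  by rewrite !normrZ !ger0_norm.
have inr s c : 0 <= s <= h -> 0 <= c <= h -> `|s *: u + c *: v| < r.
  move=> sh ch; apply: le_lt_trans (small _ _ sh ch) (le_lt_trans _ hK).
  case/andP: sh => _ sh; case/andP: ch => _ ch.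
  by rewrite /K mulrDr lerD// ler_wpM2r.
pose F (s : R) := phi (s *: u + h *: v) - phi (s *: u).
pose dF (s : R) := D (s *: u + h *: v) - D (s *: u).
have hh : 0 <= h <= h by rewrite (ltW h0) lexx.
have z0 : (0 : R) <= 0 <= h by rewrite lexx (ltW h0).
have dFP s : 0 <= s <= h -> is_derive s 1 (F : R -> R^o) (dF s).
  move=> sh.
  have line (c : V) : is_diff s (fun s : R => s *: u + c) (fun x : R => x *: u).
    by apply: is_diff_eq; rewrite addr0.
  have along c : `|s *: u + c| < r ->
      is_derive s 1 (fun s : R => phi (s *: u + c)) (D (s *: u + c)).
    move=> /rP[dp _].
    have := is_diff_comp (line c) (differentiableP dp).
    move=> [d1 d2]; apply: DeriveDef; first exact: diff_derivable.
    by rewrite deriveE// d2 /= scale1r.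
  rewrite /F /dF; apply: is_deriveB; first exact/along/inr.
  have := along 0; rewrite addr0 => H.
  have -> : (fun s : R => phi (s *: u)) = (fun s => phi (s *: u + 0)).
    by apply/funext => y; rewrite addr0.
  by apply: H; have := inr s 0 sh z0; rewrite scale0r addr0.
have [c ch Fc] : exists2 c, c \in `]0, h[%R & F h - F 0 = dF c * (h - 0).
  apply: MVT => //.
    by move=> x /[!in_itv]/= /andP[/ltW x0 /ltW xh]; apply: dFP; rewrite x0 xh.
  apply: derivable_within_continuous => x /[!in_itv]/= xh.
  by have [] := dFP _ xh.
move: ch; rewrite in_itv /= => /andP[/ltW c0 /ltW ch].
have cs : 0 <= c <= h by rewrite c0 ch.
have := Fc; rewrite /F scale0r add0r subr0 => EQ.
have -> : phi (h *: u + h *: v) - phi (h *: v) - (phi (h *: u) - phi 0)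
    = dF c * h by rewrite -EQ; ring.
have [_ r1] := rP _ (inr c h cs hh).
have := rP _ (inr c 0 cs z0); rewrite scale0r addr0 => -[_ r2].
have n1 := small c h cs hh.
have n2 := small c 0 cs z0; rewrite scale0r addr0 mul0r addr0 in n2.
have LE : L (c *: u + h *: v) = L (c *: u) + h * L v :> R.
  by rewrite linearD [L (h *: v)]linearZ.
rewrite LE in r1.
(* Both values of [D] are expanded at 0: the terms [L (c *: u)] cancel, which leaves [h * L v] up to
   two remainders. *)
have -> : dF c * h - h ^+ 2 * L v =
    h * ((D (c *: u + h *: v) - D 0 - (L (c *: u) + h * L v))
         - (D (c *: u) - D 0 - L (c *: u))) :> R by rewrite /dF; ring.
rewrite normrM gtr0_norm// expr2 -mulrA mulrCA ler_pM2l//.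
apply: (le_trans (ler_normB _ _)); apply: (le_trans (lerD r1 r2)).
rewrite -mulrDr ler_pM2l//; apply: (le_trans (lerD n1 n2)).
have : c * `|u| <= h * `|u| by rewrite ler_wpM2r.
nra.
Unshelve. all: by end_near. Qed.

(** The second difference is unchanged when [u] and [v] are exchanged, so both second derivatives
    are its limit after division by [h ^+ 2]. *)
Lemma second_diff_sym (V : normedModType R) (phi : V -> R^o) (u v : V) :
  (\forall x \near (0 : V), differentiable phi x) ->
  differentiable (fun x => 'd phi x u : R^o) (0 : V) ->
  differentiable (fun x => 'd phi x v : R^o) (0 : V) ->
  'd (fun x => 'd phi x u : R^o) (0 : V) v =
  'd (fun x => 'd phi x v : R^o) (0 : V) u.
Proof.
move=> dphi du dv; set A := LHS; set B := RHS.
apply/eqP; rewrite -subr_eq0 -normr_le0; apply/ler_addgt0Pl => e e0; rewrite addr0.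
(* The two error bounds of [second_difference] add up to the factor 3; the [+ 1] makes [K]
   positive. *)
pose K := 3 * (`|u| + `|v|) + 1.
have K0 : 0 < K by rewrite ltr_wpDl// mulr_ge0// addr_ge0.
have eK : 0 < e / K by rewrite divr_gt0.
near (0 : R)^'+ => h.
have h0 : 0 < h by near: h; exact: nbhs_right_gt.
have h20 : 0 < h ^+ 2 by rewrite exprn_gt0.
have hu : `|phi (h *: u + h *: v) - phi (h *: v) - (phi (h *: u) - phi 0)
      - h ^+ 2 * A| <= e / K * (h ^+ 2 * (2 * `|u| + `|v|)).
  by near: h; exact: second_difference.
have hv : `|phi (h *: v + h *: u) - phi (h *: u) - (phi (h *: v) - phi 0)
      - h ^+ 2 * B| <= e / K * (h ^+ 2 * (2 * `|v| + `|u|)).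
  by near: h; exact: second_difference.
rewrite [_ *: v + _ *: u]addrC in hv.
rewrite -(ler_pM2l h20) -{1}(gtr0_norm h20) -normrM.
have -> : h ^+ 2 * (A - B) =
   (phi (h *: u + h *: v) - phi (h *: u) - (phi (h *: v) - phi 0) - h ^+ 2 * B) -
   (phi (h *: u + h *: v) - phi (h *: v) - (phi (h *: u) - phi 0) - h ^+ 2 * A).
  by ring.
apply: (le_trans (ler_normB _ _)); apply: (le_trans (lerD hv hu)).
rewrite -mulrDr -mulrDr mulrCA ler_pM2l// -[leRHS](divfK (lt0r_neq0 K0)).
rewrite ler_pM2l// /K; nra.
Unshelve. all: by end_near. Qed.

End Calculus.

(** * Calculus in translation charts *)

Section LieGroups.
Context {R : realType}.
Implicit Types M N P : lieGroup R.

Lemma lie_exp0 M : lie_exp (0 : tangent M) = 0.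
Proof.
by apply: (addrI (lie_exp (0 : tangent M))); rewrite -lie_expD !addr0.
Qed.

Lemma lie_log0 M : lie_log (0 : M) = 0.
Proof. by have := nbhs_singleton (lie_expK M); rewrite lie_exp0. Qed.

Lemma local_expr0 M N (g : M -> N) q : local_expr g q 0 = 0.
Proof. by rewrite /local_expr lie_exp0 addr0 subrr lie_log0. Qed.

(* An identity of functions, not just of germs at 0, because lie_log is a global
   right inverse of lie_exp. *)
Lemma local_expr_comp M N P (g : M -> N) (k : N -> P) q :
  local_expr (k \o g) q = local_expr k (g q) \o local_expr g q.
Proof.
by apply/funext => v; rewrite /local_expr /= lie_logK [g q + _]addrC subrK.
Qed.

Lemma tdiff_linear M N (g : M -> N) q : linear (tdiff g q).
Proof. by move=> k u v; rewrite /tdiff linearP. Qed.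

Lemma tdiffP M N (g : M -> N) q : differentiable (local_expr g q) 0 ->
  is_diff (0 : tangent M) (local_expr g q) (tdiff g q).
Proof. exact: differentiableP. Qed.

Lemma is_diff_tdiff M N (g : M -> N) q (dg : tangent M -> tangent N) :
  is_diff (0 : tangent M) (local_expr g q) dg -> tdiff g q = dg.
Proof. by case. Qed.

Lemma tdiff_comp M N P (g : M -> N) (k : N -> P) q :
  differentiable (local_expr g q) (0 : tangent M) ->
  differentiable (local_expr k (g q)) (0 : tangent N) ->
  is_diff (0 : tangent M) (local_expr (k \o g) q) (tdiff k (g q) \o tdiff g q).
Proof.
move=> dg dk; rewrite local_expr_comp.
by apply: is_diff_comp; rewrite ?local_expr0; exact: tdiffP.
Qed.

Lemma local_expr_id_diff M q :
  is_diff (0 : tangent M) (local_expr (@id M) q) id.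
Proof.
apply: near_eq_is_diff (is_diff_id _).
by apply: filterS (lie_expK M) => v vE; rewrite /local_expr addrC addKr vE.
Qed.

Section Coord.
Variables (M N P : lieGroup R) (pi : N -> P).
Variable l : {linear tangent N -> tangent P}.
Hypothesis l_cont : continuous l.
Hypothesis piB : {morph pi : x y / x - y}.
Hypothesis pi_log : forall x, lie_log (pi x) = l (lie_log x).

(** [pi] stands for a coordinate projection and [l] for the same projection on tangent spaces.
    Compatibility with subtraction and logarithms gives an equality of local expressions on the
    whole tangent space. *)
Lemma tdiff_coord (F : M -> N) q dF :
  is_diff (0 : tangent M) (local_expr F q) dF ->
  is_diff (0 : tangent M) (local_expr (pi \o F) q) (l \o dF).
Proof.
move=> h; have -> : local_expr (pi \o F) q = l \o local_expr F q.
  by apply/funext => v; rewrite /local_expr /= -piB pi_log.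
exact: is_diff_linear_comp.
Qed.

End Coord.

(** [tdiff] only looks at the origin of each chart. To differentiate it in the base point, it is
    identified at nearby points with the differential of one fixed local expression. *)
Lemma local_expr_translate M N (g : M -> N) q : tdifferentiable g ->
  \forall v \near (0 : tangent M),
    is_diff v (local_expr g q) (tdiff g (q + lie_exp v)).
Proof.
move=> dg.
have cg x : {for (0 : tangent M), continuous (local_expr g x)}.
  exact: differentiable_continuous.
(* The inversion of [lie_exp] holds on a neighbourhood of each [y] close to 0; continuity of [g]
   pulls this back to [M]. *)
have expK : \forall y \near local_expr g q 0,
    \forall z \near y, lie_log (lie_exp z) = z :> tangent N.
  by rewrite local_expr0; exact: (nbhs_interior (lie_expK N)).
have cgK : \forall v \near (0 : tangent M),
    \forall z \near local_expr g q v, lie_log (lie_exp z) = z :> tangent N.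
  exact: (cg q) _ expK.
apply: filterS cgK => v vK.
pose A w := local_expr g (q + lie_exp v) w; pose B := local_expr g q v.
(* Recentring the charts adds a constant: the left side is the logarithm of [lie_exp (A w + B)], and
   [A w + B] lies where [lie_log] inverts [lie_exp]. *)
have AK : \forall w \near (0 : tangent M), local_expr g q (w + v) = A w + B.
  have cA : {for (0 : tangent M), continuous (fun w => A w + B)}.
    by apply: continuousD; [exact: cg|exact: cst_continuous].
  have vK' : \forall z \near A 0 + B, lie_log (lie_exp z) = z.
    by rewrite /A local_expr0 add0r.
  have : \forall w \near (0 : tangent M), lie_log (lie_exp (A w + B)) = A w + B.
    exact: cA _ vK'.
  apply: filterS => w wE; rewrite -[RHS]wE lie_expD /A /B /local_expr.
  by rewrite !lie_logK lie_expD [lie_exp w + _]addrC !addrA subrK.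
have AE : \forall y \near v, A (y - v) + B = local_expr g q y.
  move: AK; rewrite (near_shift v); apply: filterS => y /=.
  by rewrite sub0r subrK.
apply: near_eq_is_diff AE _.
have dA : is_diff (v - v) A (tdiff g (q + lie_exp v)).
  by rewrite subrr; exact: tdiffP.
have d1 : is_diff v (fun y => y - v) id.
  by apply: is_diff_eq; rewrite subr0.
have d2 : is_diff v (fun y => A (y - v)) (tdiff g (q + lie_exp v)).
  exact: (is_diff_comp d1 dA).
by apply: is_diff_eq; rewrite addr0.
Qed.

End LieGroups.

(** * Differentials of real-valued functions *)

Section ScalarFunctions.
Context {R : realType}.
Implicit Types M : lieGroup R.

(** The chart of the target at [phi q] is a translation, so the two functions differ by a
    constant. *)
Lemma is_tdiff_scalar M (phi : M -> R) q (d : tangent M -> R^o) :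
  is_tdiff phi q d <->
  is_diff (0 : tangent M) (fun v => phi (q + lie_exp v) : R^o) d.
Proof.
split=> h.
  have -> : (fun v => phi (q + lie_exp v) : R^o) =
      (@local_expr _ _ (vector_lie R^o) phi q + cst (phi q)).
    by apply/funext => v; rewrite !fctE /local_expr /= subrK.
  by apply: is_diff_eq; rewrite addr0.
have -> : (@local_expr _ _ (vector_lie R^o) phi q) =
    ((fun v => phi (q + lie_exp v) : R^o) - cst (phi q)).
  by apply/funext => v; rewrite !fctE.
by apply: is_diff_eq; rewrite subr0.
Qed.

Lemma is_tdiff_cst M (c : R) q : is_tdiff (fun _ : M => c) q 0.
Proof. by apply/is_tdiff_scalar; exact: is_diff_cst. Qed.

Lemma is_tdiffD M (phi psi : M -> R) q (d e : tangent M -> R^o) :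
  is_tdiff phi q d -> is_tdiff psi q e ->
  is_tdiff (fun p => phi p + psi p) q (fun v => d v + e v).
Proof.
move=> /is_tdiff_scalar h /is_tdiff_scalar k.
by apply/is_tdiff_scalar; exact: is_diffD.
Qed.

Lemma is_tdiffM M (phi psi : M -> R) q (d e : tangent M -> R^o) :
  is_tdiff phi q d -> is_tdiff psi q e ->
  is_tdiff (fun p => phi p * psi p) q (fun v => phi q * e v + psi q * d v).
Proof.
move=> /is_tdiff_scalar h /is_tdiff_scalar k; apply/is_tdiff_scalar.
by have := is_diffM h k; rewrite lie_exp0 addr0.
Qed.

Lemma is_tdiffN M (phi : M -> R) q (d : tangent M -> R^o) :
  is_tdiff phi q d -> is_tdiff (fun p => - phi p) q (fun v => - d v).
Proof.
by move=> /is_tdiff_scalar h; apply/is_tdiff_scalar; exact: is_diffN.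
Qed.

Lemma is_tdiff_fun M (phi : M -> R) q : differentiable_fun phi ->
  is_tdiff phi q (fdiff phi q).
Proof. by move=> h; exact/tdiffP/h. Qed.

Lemma fdiff_eq M (phi : M -> R) q (d : tangent M -> R^o) :
  is_tdiff phi q d -> fdiff phi q = d.
Proof. by case. Qed.

(** By [local_expr_translate], [tdiff g] at points near [q] is the ordinary differential of the
    local expression at [q], to which [second_diff_sym] applies. *)
Lemma tdiff_sym M (g : M -> circle R) q u v : tdifferentiable g ->
  (forall w, differentiable_fun (fun p => tdiff g p w)) ->
  fdiff (fun p => tdiff g p u) q v = fdiff (fun p => tdiff g p v) q u.
Proof.
move=> dg ddg; pose phi : tangent M -> R^o := local_expr g q.
have near_phi := local_expr_translate q dg.
have dphi : \forall x \near (0 : tangent M), differentiable phi x.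
  by apply: filterS near_phi => x [].
have second w : is_diff (0 : tangent M) (fun x => 'd phi x w : R^o)
    (fdiff (fun p => tdiff g p w) q).
  have := (is_tdiff_scalar _ _ _).1 (is_tdiff_fun q (ddg w)).
  apply: near_eq_is_diff; apply: filterS near_phi => x [_ dx].
  by rewrite -dx.
rewrite -(@diff_val _ _ _ _ _ _ _ (second u)).
rewrite -(@diff_val _ _ _ _ _ _ _ (second v)).
by apply: second_diff_sym => //; exact: (@ex_diff _ _ _ _ _ _ _ (second _)).
Qed.

(** Applying [tdiff_sym] to each circle coordinate [pi \o F] handles maps into a product of circles.
    The first half of the conclusion feeds the product rule. *)
Lemma tdiff_sym_coord (M N : lieGroup R) (pi : N -> circle R)
    (l : {linear tangent N -> R^o}) (F : M -> N) (q : M) (u v : tangent M) :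
  continuous l -> {morph pi : x y / x - y} ->
  (forall x, lie_log (pi x) = l (lie_log x)) ->
  tdifferentiable F ->
  (forall w, @tdifferentiable _ _ (vector_lie (tangent N))
     (fun p => tdiff F p w)) ->
  is_tdiff (fun p => l (tdiff F p v) : R) q
    (fdiff (fun p => l (tdiff F p v) : R) q) /\
  fdiff (fun p => l (tdiff F p u) : R) q v =
  fdiff (fun p => l (tdiff F p v) : R) q u.
Proof.
move=> cl piB pil dF ddF.
have piF p := @tdiff_coord R M N (circle R) pi l cl piB pil F _ _ (tdiffP (dF p)).
have lE w : (fun p => l (tdiff F p w)) = (fun p => tdiff (pi \o F) p w).
  by apply/funext => p; rewrite (is_diff_tdiff (piF p)).
have dl w : differentiable_fun (fun p => l (tdiff F p w) : R).
  move=> p; have := @tdiffP _ _ (vector_lie (tangent N)) _ _ (ddF w p).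
  move=> /(is_diff_linear_comp cl)[+ _]; rewrite (_ : l \o _ =
    @local_expr _ _ (vector_lie R^o) (fun p => l (tdiff F p w)) p) //.
  by apply/funext => x; rewrite /local_expr /= linearB.
split; first exact: is_tdiff_fun.
rewrite !lE; apply: tdiff_sym => [p|w]; last by rewrite -lE.
by case: (piF p).
Qed.

(** * Regularity classes, continuity and compactness *)

Lemma class_Cn_le k l M (N : lieGroup R) (g : M -> N) :
  (k <= l)%N -> class_Cn l g -> class_Cn k g.
Proof.
(* The target varies in the induction, because derivatives of a map into [N] take values in
   [tangent N]. *)
suff step j : forall (N : lieGroup R) (g : M -> N), class_Cn j.+1 g -> class_Cn j g.
  elim: l => [|l IH]; first by rewrite leqn0 => /eqP->.
  by rewrite leq_eqVlt => /orP[/eqP->//|/IH h /step/h].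
elim: j => [|j IH] N' g' [dg ddg]; last by split=> // v; exact: IH.
by move=> q; apply: differentiable_continuous; exact: dg.
Qed.

Lemma class_C_Cn k r M (N : lieGroup R) (g : M -> N) :
  reg_le (Some k) r -> class_C r g -> class_Cn k g.
Proof. by case: r => [l|] //= kl; exact: class_Cn_le. Qed.

(** Points carry no topology, so global continuity is stated on the tangent space through [lie_exp].
    Continuity at [v] is continuity at 0 in the chart centred at [lie_exp v]. *)
Lemma class_C0_continuous M (phi : M -> R) :
  @class_Cn R 0 M (vector_lie R^o) phi ->
  continuous (fun v => phi (lie_exp v) : R^o).
Proof.
pose shifted v w : R^o := phi (lie_exp (w + v)).
move=> cphi v; have c0 := cphi (lie_exp v).
have c1 : {for (0 : tangent M), continuous (shifted v)}.
  have -> : shifted v =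
      (@local_expr _ _ (vector_lie R^o) phi (lie_exp v) \+ cst (phi (lie_exp v))).
    by apply/funext => w; rewrite /shifted lie_expD addrC; apply/esym; exact: subrK.
  by apply: continuousD; [exact: c0|exact: cst_continuous].
have c2 : {for v, continuous (fun w : tangent M => w - v)}.
  by apply: continuousB; [exact: cvg_id|exact: cst_continuous].
have := @continuous_comp _ _ _ (fun w => w - v) (shifted v) v c2.
rewrite subrr => /(_ c1).
by under [X in {for _, continuous X} -> _]funext do rewrite /= /shifted subrK.
Qed.

(** Compactness is encoded by a compact set of tangent vectors whose exponentials cover [M]; for the
    circle the interval [-1/2, 1/2] serves. *)
Definition lie_compact M := exists2 K : set (tangent M), compact K &
  forall q : M, exists2 v, K v & lie_exp v = q.

Lemma lie_compact_circle : lie_compact (circle R).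
Proof.
exists (`[- 2^-1, 2^-1]%classic : set R); first exact: segment_compact.
move=> q; exists (lie_log q); last exact: lie_logK.
rewrite /= /circle_log in_itv /=; set x : R := repr q.
have /andP[h1 h2] := floor_itv (x + 2^-1).
rewrite intrD in h2.
by apply/andP; split; lra.
Qed.

Lemma lie_compact_prod M (N : lieGroup R) :
  lie_compact M -> lie_compact N -> lie_compact (prod_lie M N).
Proof.
move=> [K cK hK] [L cL hL]; exists (K `*` L); first exact: compact_setX.
move=> [p q]; have [u Ku <-] := hK p; have [v Lv <-] := hL q.
by exists (u, v).
Qed.

Lemma lie_bounded M (phi : M -> R) : lie_compact M ->
  continuous (fun v => phi (lie_exp v) : R^o) ->
  exists2 C, 0 < C & forall q, `|phi q| <= C.
Proof.
move=> [K cK hK] cphi.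
have [v Kv _] := hK 0.
have K0 : K !=set0 by exists v.
have cn : continuous (fun v => `|phi (lie_exp v)| : R).
  move=> w; exact: (@continuous_comp _ _ _ _ (fun x : R^o => `|x| : R) w (cphi w)
    (@norm_continuous _ R^o _)).
have [c _ cmax] := compact_EVT_max K0 cK (continuous_subspaceT cn).
exists (`|phi (lie_exp c)| + 1); first by rewrite ltr_wpDl.
move=> q; have [w Kw <-] := hK q.
by apply: (le_trans (cmax w _)); rewrite ?inE// lerDl.
Qed.

Lemma lie_bounded_inv M (phi : M -> R) : lie_compact M ->
  (forall q, phi q != 0) ->
  continuous (fun v => phi (lie_exp v) : R^o) ->
  exists2 C, 0 < C & forall q, `|phi q|^-1 <= C.
Proof.
move=> cM n0 cphi.
have [C C0 hC] : exists2 C, 0 < C & forall q, `|(phi q)^-1| <= C.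
  apply: lie_bounded => // v.
  apply: (@continuousV R (tangent M) (fun v => phi (lie_exp v))).
    exact: n0.
  exact: cphi.
by exists C => // q; rewrite -normfV.
Qed.

End ScalarFunctions.

(** * One-forms on the 3-torus *)

Section Components.
Context {R : realType}.

Lemma linear_coord2 (f : R^o * R^o -> R^o) : linear f ->
  forall v, f v = v.1 * f (1, 0) + v.2 * f (0, 1).
Proof.
move=> lf; have f0 : f 0 = 0.
  by apply: (addrI (f 0)); rewrite addr0 -[X in X + _]scale1r -lf scale1r addr0.
case=> x y.
have e : (x, y) = x *: (1, 0) + (y *: (0, 1) + 0) :> R^o * R^o.
  by congr pair; rewrite /= -![_ *: _]/(_ * _); ring.
by rewrite [in LHS]e !lf f0 addr0.
Qed.

Lemma linear_coord3 (f : R^o * R^o * R^o -> R^o) : linear f ->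
  forall v, f v = v.1.1 * f (1, 0, 0) + v.1.2 * f (0, 1, 0) + v.2 * f (0, 0, 1).
Proof.
move=> lf; have f0 : f 0 = 0.
  by apply: (addrI (f 0)); rewrite addr0 -[X in X + _]scale1r -lf scale1r addr0.
case=> -[x y] z.
have e : (x, y, z) = x *: (1, 0, 0) + (y *: (0, 1, 0) + (z *: (0, 0, 1) + 0))
    :> R^o * R^o * R^o.
  by congr (_, _, _); rewrite /= -![_ *: _]/(_ * _); ring.
by rewrite [in LHS]e !lf f0 addr0 addrA.
Qed.

End Components.

Section OneForms.
Context {R : realType}.
Local Notation T3 := (prod_lie (torus2 R) (circle R)).

Definition det3 (u v w : R^o * R^o * R^o) : R :=
  u.1.1 * (v.1.2 * w.2 - v.2 * w.1.2)
  + u.1.2 * (v.2 * w.1.1 - v.1.1 * w.2)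
  + u.2 * (v.1.1 * w.1.2 - v.1.2 * w.1.1).

Lemma fun_linear_coord3 (a : T3 -> tangent T3 -> R) v :
  (forall q, linear (a q : tangent T3 -> R^o)) ->
  (fun q => a q v) = (fun q => v.1.1 * a q (1, 0, 0) + v.1.2 * a q (0, 1, 0)
                     + v.2 * a q (0, 0, 1)).
Proof. by move=> la; apply/funext => q; exact: (linear_coord3 (la q)). Qed.

Lemma form_diff (a : T3 -> tangent T3 -> R) q u v :
  (forall q, linear (a q : tangent T3 -> R^o)) ->
  (forall w, differentiable_fun (fun q => a q w)) ->
  fdiff (fun p => a p v) q u =
    v.1.1 * fdiff (fun p => a p (1, 0, 0)) q u
    + v.1.2 * fdiff (fun p => a p (0, 1, 0)) q u
    + v.2 * fdiff (fun p => a p (0, 0, 1)) q u.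
Proof.
move=> la da; rewrite (fun_linear_coord3 v la).
have sc (c : R) (w : tangent T3) : is_tdiff (fun p => c * a p w) q
    (fun x => c * fdiff (fun p => a p w) q x).
  have := is_tdiffM (is_tdiff_cst c q) (is_tdiff_fun q (da w)).
  by under [X in is_diff _ _ X]funext do rewrite mulr0 addr0.
have := is_tdiffD (is_tdiffD (sc v.1.1 (1, 0, 0)) (sc v.1.2 (0, 1, 0)))
  (sc v.2 (0, 0, 1)).
by move=> /fdiff_eq ->.
Qed.

(** An alternating trilinear form on a three-dimensional space is a multiple of the determinant; in
    coordinates this is a polynomial identity. *)
Lemma wedge_det (a : T3 -> tangent T3 -> R) q u v w :
  (forall q, linear (a q : tangent T3 -> R^o)) ->
  (forall w, differentiable_fun (fun q => a q w)) ->
  wedge_ext_deriv a q u v w =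
    det3 u v w * wedge_ext_deriv a q (1, 0, 0) (0, 1, 0) (0, 0, 1).
Proof.
move=> la da.
(* [d] hides the derivatives behind an opaque name, so that the final identity is polynomial in its
   entries. *)
have [d dE] : exists d : tangent T3 -> tangent T3 -> R,
    forall x y, d x y = fdiff (fun p => a p x) q y by eexists.
have fd x y : d x y =
    x.1.1 * (y.1.1 * d (1, 0, 0) (1, 0, 0) + y.1.2 * d (1, 0, 0) (0, 1, 0)
             + y.2 * d (1, 0, 0) (0, 0, 1))
    + x.1.2 * (y.1.1 * d (0, 1, 0) (1, 0, 0) + y.1.2 * d (0, 1, 0) (0, 1, 0)
               + y.2 * d (0, 1, 0) (0, 0, 1))
    + x.2 * (y.1.1 * d (0, 0, 1) (1, 0, 0) + y.1.2 * d (0, 0, 1) (0, 1, 0)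
             + y.2 * d (0, 0, 1) (0, 0, 1)).
  have lin z := linear_coord3 (@tdiff_linear _ _ (vector_lie R^o) (fun p => a p z) q) y.
  rewrite !dE (form_diff _ _ _ la da).
  by rewrite (lin (1, 0, 0)) (lin (0, 1, 0)) (lin (0, 0, 1)).
rewrite /wedge_ext_deriv /ext_deriv -!dE /det3.
rewrite (fd u v) (fd u w) (fd v u) (fd v w) (fd w u) (fd w v).
rewrite (linear_coord3 (la q) u) (linear_coord3 (la q) v) (linear_coord3 (la q) w).
move: (d (1, 0, 0) (1, 0, 0)) (d (1, 0, 0) (0, 1, 0)) (d (1, 0, 0) (0, 0, 1))
  (d (0, 1, 0) (1, 0, 0)) (d (0, 1, 0) (0, 1, 0)) (d (0, 1, 0) (0, 0, 1))
  (d (0, 0, 1) (1, 0, 0)) (d (0, 0, 1) (0, 1, 0)) (d (0, 0, 1) (0, 0, 1))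
  (a q (1, 0, 0)) (a q (0, 1, 0)) (a q (0, 0, 1)).
move: u v w => [[u1 u2] u3] [[v1 v2] v3] [[w1 w2] w3] /= {fd dE d}.
move=> d11 d12 d13 d21 d22 d23 d31 d32 d33 a1 a2 a3.
ring.
Qed.

End OneForms.

(** * Pullback of a one-form that F multiplies by tau *)

Section Pullback.
Context {R : realType}.
Local Notation T3 := (prod_lie (torus2 R) (circle R)).

Variables (a : T3 -> tangent T3 -> R) (F : T3 -> T3) (tau : T3 -> R).
Hypothesis a_linear : forall q, linear (a q : tangent T3 -> R^o).
Hypothesis a_diff : forall w, differentiable_fun (fun q => a q w).
Hypothesis F_diff : tdifferentiable F.
Hypothesis F_diff2 : forall w,
  @tdifferentiable _ _ (vector_lie (tangent T3)) (fun p => tdiff F p w).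
Hypothesis tau_diff : differentiable_fun tau.
Hypothesis pullF : forall q v, a (F q) (tdiff F q v) = tau q * a q v.

Lemma is_tdiff_comp_fun (phi : T3 -> R) q : differentiable_fun phi ->
  is_tdiff (fun p => phi (F p)) q (fun u => fdiff phi (F q) (tdiff F q u)).
Proof. by move=> dphi; apply: (@tdiff_comp _ _ _ (vector_lie R^o) F phi). Qed.

(* The second derivatives of F cancel by symmetry; this is where F being C^2 is
   needed. *)
Lemma pullback_ext_deriv q u v :
  ext_deriv a (F q) (tdiff F q u) (tdiff F q v) =
  tau q * ext_deriv a q u v + fdiff tau q u * a q v - fdiff tau q v * a q u.
Proof.
pose l1 : {linear tangent T3 -> R^o} := fst \o fst.
pose l2 : {linear tangent T3 -> R^o} := snd \o fst.
pose l3 : {linear tangent T3 -> R^o} := snd.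
have cl1 : continuous l1.
  by move=> x; apply: (@cvg_comp _ _ _ fst fst) cvg_fst cvg_fst.
have cl2 : continuous l2.
  by move=> x; apply: (@cvg_comp _ _ _ fst snd) cvg_fst cvg_snd.
have cl3 : continuous l3 by move=> x; exact: cvg_snd.
have sym1 := tdiff_sym_coord (pi := fun x : T3 => x.1.1) q _ _ cl1
  (fun _ _ => erefl) (fun _ => erefl) F_diff F_diff2.
have sym2 := tdiff_sym_coord (pi := fun x : T3 => x.1.2) q _ _ cl2
  (fun _ _ => erefl) (fun _ => erefl) F_diff F_diff2.
have sym3 := tdiff_sym_coord (pi := fun x : T3 => x.2) q _ _ cl3
  (fun _ _ => erefl) (fun _ => erefl) F_diff F_diff2.
have regroup (c1 c2 c3 b1 b2 b3 x1 x2 x3 d1 d2 d3 : R) :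
    c1 * x1 + b1 * d1 + (c2 * x2 + b2 * d2) + (c3 * x3 + b3 * d3) =
    c1 * x1 + c2 * x2 + c3 * x3 + (b1 * d1 + b2 * d2 + b3 * d3) by ring.
(* Product rule: the first term differentiates the coefficients of [a] with the vector frozen at
   [q]; the others carry the second derivatives of [F]. *)
have lhs x y : fdiff (fun p => a (F p) (tdiff F p x)) q y =
   fdiff (fun p => a p (tdiff F q x)) (F q) (tdiff F q y)
   + (a (F q) (1, 0, 0) * fdiff (fun p => l1 (tdiff F p x) : R) q y
    + a (F q) (0, 1, 0) * fdiff (fun p => l2 (tdiff F p x) : R) q y
    + a (F q) (0, 0, 1) * fdiff (fun p => l3 (tdiff F p x) : R) q y).
  have fE : (fun p => a (F p) (tdiff F p x)) = (fun p =>
      l1 (tdiff F p x) * a (F p) (1, 0, 0) + l2 (tdiff F p x) * a (F p) (0, 1, 0)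
      + l3 (tdiff F p x) * a (F p) (0, 0, 1)).
    by apply/funext => p; exact: (linear_coord3 (a_linear (F p))).
  have [d1 _] := sym1 x x; have [d2 _] := sym2 x x; have [d3 _] := sym3 x x.
  have := is_tdiffD (is_tdiffD
    (is_tdiffM d1 (is_tdiff_comp_fun q (a_diff (1, 0, 0))))
    (is_tdiffM d2 (is_tdiff_comp_fun q (a_diff (0, 1, 0)))))
    (is_tdiffM d3 (is_tdiff_comp_fun q (a_diff (0, 0, 1)))).
  move=> /fdiff_eq fE'; apply: etrans (congr1 (fun h => fdiff h q y) fE) _.
  rewrite fE' [X in _ = X + _](form_diff _ _ _ a_linear a_diff).
  exact: regroup.
have rhs x y : fdiff (fun p => a (F p) (tdiff F p x)) q y =
    tau q * fdiff (fun p => a p x) q y + a q x * fdiff tau q y.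
  have fE : (fun p => a (F p) (tdiff F p x)) = (fun p => tau p * a p x).
    by apply/funext => p; exact: pullF.
  apply: etrans (congr1 (fun h => fdiff h q y) fE) _.
  have := is_tdiffM (is_tdiff_fun q tau_diff) (is_tdiff_fun q (a_diff x)).
  by move=> /fdiff_eq ->.
have eq1 := etrans (esym (lhs v u)) (rhs v u).
have eq2 := etrans (esym (lhs u v)) (rhs u v).
(* By symmetry [eq1] and [eq2] now share their second-derivative terms, which the subtraction
   removes. What remains is d(tau a) = tau da + dtau /\ a. *)
have [_ s1] := sym1 u v; have [_ s2] := sym2 u v; have [_ s3] := sym3 u v.
rewrite s1 s2 s3 in eq2.
rewrite /ext_deriv.
apply: etrans (congr2 (fun b c => b - c) (canRL (addrK _) eq1) (canRL (addrK _) eq2)) _.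
have cancel (t x y z b c : R) :
  t * x + b - z - (t * y + c - z) = t * (x - y) + b - c by ring.
rewrite [fdiff tau q u * _]mulrC [fdiff tau q v * _]mulrC.
exact: cancel.
Qed.

(** In tau a /\ (tau da + dtau /\ a) the last term drops out because a /\ dtau /\ a = 0. The
    determinant comes from [wedge_det] at [F q]. *)
Lemma pullback_wedge q :
  det3 (tdiff F q (1, 0, 0)) (tdiff F q (0, 1, 0)) (tdiff F q (0, 0, 1))
  * wedge_ext_deriv a (F q) (1, 0, 0) (0, 1, 0) (0, 0, 1) =
  tau q ^+ 2 * wedge_ext_deriv a q (1, 0, 0) (0, 1, 0) (0, 0, 1).
Proof.
rewrite -wedge_det// /wedge_ext_deriv !pullF !pullback_ext_deriv.
move: (ext_deriv a q (0, 1, 0) (0, 0, 1)) (ext_deriv a q (0, 0, 1) (1, 0, 0))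
  (ext_deriv a q (1, 0, 0) (0, 1, 0)) (a q (1, 0, 0)) (a q (0, 1, 0))
  (a q (0, 0, 1)) (tau q) (fdiff tau q (1, 0, 0)) (fdiff tau q (0, 1, 0))
  (fdiff tau q (0, 0, 1)) => e1 e2 e3 a1 a2 a3 t t1 t2 t3.
ring.
Qed.

End Pullback.

(** * Skew-products over a coboundary *)

Section Skew.
Context {R : realType}.
Local Notation T2 := (torus2 R).
Local Notation T3 := (prod_lie (torus2 R) (circle R)).

Lemma local_expr_fst_diff (M N : lieGroup R) (q : prod_lie M N) :
  is_diff (0 : tangent (prod_lie M N))
    (@local_expr _ (prod_lie M N) M (fun z => z.1) q) fst.
Proof.
have cfst : continuous (@fst (tangent M) (tangent N)) by move=> y; exact: cvg_fst.
exact: (@tdiff_coord _ _ (prod_lie M N) M fst fst cfst (fun _ _ => erefl)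
  (fun _ => erefl) id q id (local_expr_id_diff q)).
Qed.

Variables (f : T2 -> T2) (gamma mu : T2 -> circle R).
Local Notation F := (skew_product f gamma).
Hypothesis f_diff : tdifferentiable f.
Hypothesis F_diff : tdifferentiable F.
Hypothesis mu_diff : tdifferentiable mu.
Hypothesis gammaE : forall p, gamma p = mu (f p) - mu p.

Definition graph (t : circle R) (p : T2) : T3 := (p, t + mu p).

Lemma graph_tdiff t p :
  is_diff (0 : tangent T2) (local_expr (graph t) p) (fun v => (v, tdiff mu p v)).
Proof.
have -> : local_expr (graph t) p =
    (fun v => (local_expr (@id T2) p v, local_expr mu p v)).
  apply/funext => v; congr pair.
  rewrite /local_expr; congr (lie_log _).
  by rewrite -[LHS]/(t + mu (p + lie_exp v) - (t + mu p)) opprD addrACA subrr add0r.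
exact: (is_diff_pair (local_expr_id_diff p) (tdiffP (mu_diff p))).
Qed.

(** The coboundary equation is precisely the invariance of the translated graphs. *)
Lemma skew_graph t p : F (graph t p) = graph t (f p).
Proof.
rewrite /skew_product /graph /= gammaE; congr pair.
by rewrite -addrA [mu p + _]addrC subrK.
Qed.

(** Chain rule on both sides of [F \o graph t = graph t \o f]: DF preserves the tangent planes of
    the graphs and acts on them as Df. *)
Lemma skew_tdiff_graph t p v :
  tdiff F (graph t p) (v, tdiff mu p v) =
  (tdiff f p v, tdiff mu (f p) (tdiff f p v)).
Proof.
have [dg _] := graph_tdiff t p; have [dg' _] := graph_tdiff t (f p).
have h1 := tdiff_comp dg (F_diff (graph t p)).
have h2 := tdiff_comp (f_diff p) dg'.
have E : F \o graph t = graph t \o f.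
  by apply/funext => x; exact: skew_graph.
have e1 := etrans (esym (congr1 (fun h => tdiff h p) E)) (is_diff_tdiff h1).
have e := congr1 (fun h => h v) (etrans (esym e1) (is_diff_tdiff h2)).
have g1 := congr1 (fun h => h v) (is_diff_tdiff (graph_tdiff t p)).
have g2 := congr1 (fun h => h (tdiff f p v)) (is_diff_tdiff (graph_tdiff t (f p))).
exact: etrans (esym (congr1 (tdiff F (graph t p)) g1)) (etrans e g2).
Qed.

(** F commutes with rotations of the fibre. [J y] parametrises the fibre through [y], and
    [F \o J z = J (F z)] is differentiated at 0. *)
Lemma skew_tdiff_fiber z : tdiff F z (0, 0, 1) = (0, 0, 1) :> R^o * R^o * R^o.
Proof.
pose J (y : T3) (s : circle R) : T3 := (y.1, y.2 + s).
have J0 y : J y 0 = y by case: y => y1 y2; rewrite /J addr0.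
have dJ y : is_diff (0 : tangent (circle R)) (local_expr (J y) 0) (fun s => (0, s)).
  have -> : local_expr (J y) 0 = (fun s => (0, local_expr (@id (circle R)) 0 s)).
    apply/funext => s; congr pair.
      by rewrite -[LHS]/(lie_log (y.1 - y.1)) subrr lie_log0.
    rewrite -[LHS]/(lie_log (y.2 + (0 + lie_exp s) - (y.2 + 0))) /local_expr.
    by rewrite opprD addrACA subrr add0r.
  exact: (is_diff_pair (is_diff_cst (0 : tangent T2) _)
    (local_expr_id_diff (0 : circle R))).
have E : F \o J z = J (F z).
  by apply/funext => s; rewrite /skew_product /J /= addrAC.
have [d _] := dJ z; have := tdiff_comp d (F_diff (J z 0)).
rewrite J0 => /is_diff_tdiff/(congr1 (fun k => k (1 : R^o))) e.
have e1 := congr1 (fun h : circle R -> T3 => tdiff h 0 (1 : R^o)) E.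
have j1 := congr1 (fun h => h (1 : R^o)) (is_diff_tdiff (dJ z)).
have j2 := congr1 (fun h => h (1 : R^o)) (is_diff_tdiff (dJ (F z))).
exact: etrans (esym (congr1 (tdiff F z) j1)) (etrans (esym e) (etrans e1 j2)).
Qed.

(** The projection to the base semiconjugates F to [f]; both sides are differentiated. *)
Lemma skew_tdiff_base z w : (tdiff F z w).1 = tdiff f z.1 w.1.
Proof.
have cfst : continuous (@fst (tangent T2) (tangent (circle R))).
  by move=> y; exact: cvg_fst.
have h1 := @tdiff_coord _ T3 T3 T2 fst fst cfst (fun _ _ => erefl)
  (fun _ => erefl) F z _ (tdiffP (F_diff z)).
have p1 := local_expr_fst_diff z.
have h2 := tdiff_comp (@ex_diff _ _ _ _ _ _ _ p1) (f_diff z.1).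
have e1 := is_diff_tdiff h1; have e2 := is_diff_tdiff h2.
have e3 := is_diff_tdiff p1.
have := etrans (esym e1) e2 => /(congr1 (fun k => k w)) /= ->.
by rewrite e3.
Qed.

End Skew.

(** * The invariant quadratic form *)

Section Area.
Context {R : realType}.
Local Notation T2 := (torus2 R).
Local Notation T3 := (prod_lie (torus2 R) (circle R)).

Lemma sqr_sum_bound (x1 x2 y1 y2 k1 k2 : R) : `|x1| <= k1 -> `|x2| <= k2 ->
  (y1 * x1 + y2 * x2) ^+ 2 <= 2 * (k1 ^+ 2 + k2 ^+ 2) * (y1 ^+ 2 + y2 ^+ 2).
Proof.
have sqr_bound (x k : R) : `|x| <= k -> x ^+ 2 <= k ^+ 2.
  by move=> xk; rewrite -real_normK ?num_real// lerXn2r ?nnegrE ?(le_trans _ xk).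
move=> /sqr_bound h1 /sqr_bound h2.
apply: (@le_trans _ _ (2 * (x1 ^+ 2 + x2 ^+ 2) * (y1 ^+ 2 + y2 ^+ 2))).
  rewrite -subr_ge0.
  (* Lagrange identity, doubled: Cauchy-Schwarz with a spare factor 2. *)
  have -> : 2 * (x1 ^+ 2 + x2 ^+ 2) * (y1 ^+ 2 + y2 ^+ 2) - (y1 * x1 + y2 * x2) ^+ 2
     = (y1 * x1 + y2 * x2) ^+ 2 + 2 * (y1 * x2 - y2 * x1) ^+ 2 by ring.
  by rewrite addr_ge0 ?sqr_ge0// mulr_ge0 ?sqr_ge0.
by rewrite ler_wpM2r ?addr_ge0 ?sqr_ge0// ler_pM2l// lerD.
Qed.

(** [r] stands for tau, [x] for the absolute value of det Df, [m] for the area density at the image,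
    [c0] and [c1] for the contact densities before and after F. The two factors [r ^+ 2] cancel. *)
Lemma rescale_density (b m r x c0 c1 : R) : r != 0 -> x != 0 -> c1 != 0 ->
  x * c1 = r ^+ 2 * c0 -> (r * b) ^+ 2 * m / c1 = b ^+ 2 * (x * m) / c0.
Proof.
move=> r0 x0 n1 xc; have -> : c0 = x * c1 / r ^+ 2.
  by rewrite xc mulrAC divff ?mul1r// expf_neq0.
by field; rewrite r0 x0 n1.
Qed.

Definition det2 (u v : R^o * R^o) : R := u.1 * v.2 - u.2 * v.1.

Lemma area_form_det w p (u v : tangent T2) : area_form w ->
  w p u v = det2 u v * w p (1, 0) (0, 1).
Proof.
move=> [lw wC _ _].
have ww x : w p x x = 0 by have := wC p x x; lra.
rewrite (linear_coord2 (lw p u) v) (wC p u (1, 0)) (wC p u (0, 1)).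
rewrite (linear_coord2 (lw p (1, 0)) u) (linear_coord2 (lw p (0, 1)) u) !ww.
rewrite (wC p (0, 1) (1, 0)) /det2.
move: (w p _ _) => c; case: u => u1 u2; case: v => v1 v2 /=; ring.
Qed.

Lemma area_form_neq0 (w : T2 -> tangent T2 -> tangent T2 -> R) p :
  area_form w -> w p (1, 0) (0, 1) != 0.
Proof.
move=> wP; have [_ _ w0 _] := wP; have [u [v]] := w0 p.
by rewrite (area_form_det _ _ _ wP) mulf_eq0 negb_or => /andP[].
Qed.

Section ContinuousFun.
Variables (T : topologicalType) (f g : T -> R).
Hypotheses (cf : continuous (f : T -> R^o)) (cg : continuous (g : T -> R^o)).

Lemma continuous_fun_add : continuous (fun x => f x + g x : R^o).
Proof. by move=> x; exact: (@continuousD R R^o T f g x (@cf x) (@cg x)). Qed.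

Lemma continuous_fun_sub : continuous (fun x => f x - g x : R^o).
Proof. by move=> x; exact: (@continuousB R R^o T f g x (@cf x) (@cg x)). Qed.

Lemma continuous_fun_mul : continuous (fun x => f x * g x : R^o).
Proof. by move=> x; exact: (@continuousM R T f g x (@cf x) (@cg x)). Qed.

End ContinuousFun.

Lemma smooth_continuous (M : lieGroup R) (phi : M -> R) : smooth_fun phi ->
  continuous (fun v => phi (lie_exp v) : R^o).
Proof. by move=> s; apply: class_C0_continuous; exact: (s 0%N). Qed.

Lemma torus2_compact : lie_compact T2.
Proof. by apply: lie_compact_prod; exact: lie_compact_circle. Qed.

Lemma torus3_compact : lie_compact T3.
Proof.
by apply: lie_compact_prod; [exact: torus2_compact|exact: lie_compact_circle].
Qed.

(* The smallest eigenvalue of a positive 2x2 matrix is at least det / trace. *)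
Lemma riemannian_lower_bound (g : T2 -> tangent T2 -> tangent T2 -> R) :
  riemannian (M := T2) g -> exists2 K, 0 < K &
    forall p (v : tangent T2), v.1 ^+ 2 + v.2 ^+ 2 <= K * g p v v.
Proof.
move=> [lg gC gpos gsm].
pose E p := g p (1, 0) (1, 0); pose B p := g p (1, 0) (0, 1).
pose G p := g p (0, 1) (0, 1).
have gE p v : g p v v = v.1 ^+ 2 * E p + 2 * (v.1 * v.2 * B p) + v.2 ^+ 2 * G p.
  rewrite (linear_coord2 (lg p v) v) (gC p v (1, 0)) (gC p v (0, 1)).
  rewrite (linear_coord2 (lg p (1, 0)) v) (linear_coord2 (lg p (0, 1)) v).
  rewrite (gC p (0, 1) (1, 0)) -/(E p) -/(B p) -/(G p).
  move: (E p) (B p) (G p) => e b c; case: v => v1 v2 /=; ring.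
have E0 p : 0 < E p by apply: gpos; apply/eqP => -[/eqP]; rewrite oner_eq0.
have G0 p : 0 < G p by apply: gpos; apply/eqP => -[/eqP]; rewrite oner_eq0.
(* The vector (B, -E) is orthogonal to (1, 0), and its squared length is E times the determinant. *)
have D0 p : 0 < E p * G p - B p ^+ 2.
  have : 0 < g p (B p, - E p) (B p, - E p).
    by apply: gpos; apply/eqP => -[_ /eqP]; rewrite oppr_eq0 gt_eqF.
  rewrite gE /=; move: (E p) (B p) (G p) (E0 p) => e b c e0.
  have -> : b ^+ 2 * e + 2 * (b * - e * b) + (- e) ^+ 2 * c = e * (e * c - b ^+ 2).
    by ring.
  by rewrite pmulr_rgt0.
have cE := smooth_continuous (gsm (1, 0) (1, 0)).
have cB := smooth_continuous (gsm (1, 0) (0, 1)).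
have cG := smooth_continuous (gsm (0, 1) (0, 1)).
have cD : continuous (fun v : tangent T2 => E (lie_exp v) * G (lie_exp v)
    - B (lie_exp v) * B (lie_exp v) : R^o).
  exact: continuous_fun_sub (continuous_fun_mul cE cG) (continuous_fun_mul cB cB).
have D0' p : E p * G p - B p * B p != 0 by rewrite -expr2 gt_eqF.
have [KE KE0 hE] := lie_bounded (phi := E) torus2_compact cE.
have [KG KG0 hG] := lie_bounded (phi := G) torus2_compact cG.
have [KD KD0 hD] := lie_bounded_inv torus2_compact D0' cD.
exists ((KE + KG) * KD); first by rewrite mulr_gt0// addr_gt0.
move=> p v; rewrite gE.
move: (hE p) (hG p) (hD p) (E0 p) (G0 p) (D0 p); rewrite -/(E p) -/(G p).
rewrite -expr2; move: (E p) (B p) (G p) => e b c he hc hd e0 c0 d0.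
rewrite gtr0_norm// in he; rewrite gtr0_norm// in hc; rewrite gtr0_norm// in hd.
case: v => x y /=; set n := x ^+ 2 * e + _ + _.
have n0 : 0 <= n.
  rewrite -(pmulr_rge0 _ e0).
  have -> : e * n = (e * x + b * y) ^+ 2 + (e * c - b ^+ 2) * y ^+ 2.
    by rewrite /n; ring.
  by rewrite addr_ge0 ?sqr_ge0// mulr_ge0 ?sqr_ge0// ltW.
(* Cayley-Hamilton for the Gram matrix A: tr A times the form at v, minus det A times the squared
   length of v, is the squared length of Av. *)
have le1 : (e * c - b ^+ 2) * (x ^+ 2 + y ^+ 2) <= (e + c) * n.
  rewrite -subr_ge0.
  have -> : (e + c) * n - (e * c - b ^+ 2) * (x ^+ 2 + y ^+ 2) =
    (b * x + c * y) ^+ 2 + (e * x + b * y) ^+ 2 by rewrite /n; ring.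
  by rewrite addr_ge0 ?sqr_ge0.
rewrite -ler_pdivlMl// in le1; apply: (le_trans le1).
rewrite mulrA [_^-1 * _]mulrC ler_wpM2r// ler_pM ?invr_ge0 ?(ltW d0)//.
  by rewrite addr_ge0 ?ltW.
exact: lerD.
Qed.

End Area.

(** * Invariance and boundedness of the quadratic form *)

Section Invariant.
Context {R : realType}.
Local Notation T2 := (torus2 R).
Local Notation T3 := (prod_lie (torus2 R) (circle R)).
Variables (f : T2 -> T2) (gamma mu : T2 -> circle R).
Local Notation F := (skew_product f gamma).
Variables (a : T3 -> tangent T3 -> R) (tau : T3 -> R)
  (w : T2 -> tangent T2 -> tangent T2 -> R).
Hypothesis f_diff : tdifferentiable f.
Hypothesis F_diff : tdifferentiable F.
Hypothesis F_diff2 : forall v,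
  @tdifferentiable _ _ (vector_lie (tangent T3)) (fun p => tdiff F p v).
Hypothesis mu_diff : tdifferentiable mu.
Hypothesis mu_diff2 : forall v, differentiable_fun (fun p => tdiff mu p v : R).
Hypothesis gammaE : forall p, gamma p = mu (f p) - mu p.
Hypothesis a_contact : contact_form a.
Hypothesis tau_diff : differentiable_fun tau.
Hypothesis tau_gt0 : forall z, 0 < tau z.
Hypothesis pullF : forall z v, a (F z) (tdiff F z v) = tau z * a z v.
Hypothesis wP : area_form w.
Hypothesis f_area : forall p u v,
  `|w (f p) (tdiff f p u) (tdiff f p v)| = `|w p u v|.

Let a_linear z : linear (a z : tangent T3 -> R^o).
Proof. by case: a_contact => -[+ _] _; apply. Qed.

Let a_smooth v : smooth_fun (fun z => a z v).
Proof. by case: a_contact => -[_ +] _; apply. Qed.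

Let a_diff v : differentiable_fun (fun z => a z v).
Proof. by have [] := a_smooth v 1%N. Qed.

Definition contact_density z := wedge_ext_deriv a z (1, 0, 0) (0, 1, 0) (0, 0, 1).
Definition area_density p := w p (1, 0) (0, 1).

(** By [wedge_det], a zero value on the standard basis would make the wedge vanish on every
    triple. *)
Lemma contact_density_neq0 z : contact_density z != 0.
Proof.
have [_ /(_ z)[u [v [x]]]] := a_contact.
by rewrite wedge_det// mulf_eq0 negb_or => /andP[].
Qed.

Lemma contact_density_continuous :
  continuous (fun v => contact_density (lie_exp v) : R^o).
Proof.
have ca v := smooth_continuous (a_smooth v).
have cd v u : continuous (fun x => fdiff (fun z => a z v) (lie_exp x) u : R^o).
  apply: (@class_C0_continuous R T3 (fun z => fdiff (fun z => a z v) z u : R)).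
  by have [_ /(_ u)] := a_smooth v 1%N.
have term u v x := continuous_fun_mul (ca u) (continuous_fun_sub (cd x v) (cd v x)).
exact: continuous_fun_add (continuous_fun_add (term _ _ _) (term _ _ _)) (term _ _ _).
Qed.

(* d is det Df, which is also det DF since F is an isometry along the fibres. *)
Lemma skew_density z : exists2 d : R, d != 0 &
  d * contact_density (F z) = tau z ^+ 2 * contact_density z /\
  `|d| * `|area_density (f z.1)| = `|area_density z.1|.
Proof.
pose d := det2 (tdiff f z.1 (1, 0)) (tdiff f z.1 (0, 1)).
have dw : `|d| * `|area_density (f z.1)| = `|area_density z.1|.
  by rewrite -normrM -[RHS]f_area (area_form_det _ _ _ wP).
exists d.
  apply: contra_eqN dw => /eqP ->; rewrite normr0 mul0r eq_sym normr_eq0.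
  exact: area_form_neq0.
split; last exact: dw.
have := pullback_wedge a_linear a_diff F_diff F_diff2 tau_diff pullF z.
rewrite -/(contact_density _) -/(contact_density _) => <-; congr (_ * _).
have b1 := skew_tdiff_base f_diff F_diff z (1, 0, 0).
have b2 := skew_tdiff_base f_diff F_diff z (0, 1, 0).
rewrite /det3 b1 b2 (skew_tdiff_fiber F_diff z) /d /det2 /=.
move: (tdiff F z (1, 0, 0)).2 (tdiff F z (0, 1, 0)).2 => s t.
move: (tdiff f z.1 (1, 0)) (tdiff f z.1 (0, 1)) => [x1 x2] [y1 y2] /=.
ring.
Qed.

(** The weights balance: along F the square gains tau^2, the contact density tau^2 / det Df and the
    area density 1 / det Df up to sign. Absolute values absorb the orientations. *)
Definition invariant_form t p v :=
  a (graph mu t p) (v, tdiff mu p v) ^+ 2 * `|area_density p|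
  / `|contact_density (graph mu t p)|.

Lemma invariant_formE t p v :
  invariant_form t (f p) (tdiff f p v) = invariant_form t p v.
Proof.
rewrite /invariant_form -(skew_tdiff_graph f_diff F_diff mu_diff gammaE t).
rewrite -(skew_graph gammaE) pullF.
have [d d0 [dc da]] := skew_density (graph mu t p).
rewrite /= in da; rewrite -da.
have dens : `|d| * `|contact_density (F (graph mu t p))| =
    tau (graph mu t p) ^+ 2 * `|contact_density (graph mu t p)|.
  by rewrite -normrM dc normrM normrX (gtr0_norm (tau_gt0 _)).
have c0 : `|contact_density (F (graph mu t p))| != 0.
  by rewrite normr_eq0 contact_density_neq0.
have d0' : `|d| != 0 by rewrite normr_eq0.
exact: (rescale_density _ _ (lt0r_neq0 (tau_gt0 _)) d0' c0 dens).
Qed.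

(** All coefficients are continuous on compact tori, and the contact density stays away from 0. *)
Lemma invariant_form_bound : exists2 K, 0 <= K &
  forall t p (v : tangent T2), invariant_form t p v <= K * (v.1 ^+ 2 + v.2 ^+ 2).
Proof.
have bound v := lie_bounded (phi := fun z => a z v) torus3_compact
  (smooth_continuous (a_smooth v)).
have [A1 A10 hA1] := bound (1, 0, 0).
have [A2 A20 hA2] := bound (0, 1, 0).
have [A3 A30 hA3] := bound (0, 0, 1).
have bmu v : exists2 C, 0 < C & forall p, `|tdiff mu p v : R| <= C.
  apply: lie_bounded; first exact: torus2_compact.
  apply: (@class_C0_continuous R T2 (fun p => tdiff mu p v : R)) => p.
  exact/differentiable_continuous/mu_diff2.
have [B1 B10 hB1] := bmu (1, 0).
have [B2 B20 hB2] := bmu (0, 1).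
have [W W0 hW] : exists2 C, 0 < C & forall p, `|area_density p| <= C.
  apply: lie_bounded; first exact: torus2_compact.
  by apply: smooth_continuous; have [_ _ _] := wP; exact.
have [C C0 hC] := lie_bounded_inv torus3_compact contact_density_neq0
  contact_density_continuous.
(* Bounds for the values of [a] on the graph vectors over (1, 0) and (0, 1). *)
pose K1 := A1 + B1 * A3; pose K2 := A2 + B2 * A3.
have K10 : 0 <= K1 by rewrite /K1 addr_ge0 ?mulr_ge0 ?ltW.
have K20 : 0 <= K2 by rewrite /K2 addr_ge0 ?mulr_ge0 ?ltW.
exists (2 * (K1 ^+ 2 + K2 ^+ 2) * W * C).
  by rewrite !mulr_ge0 ?addr_ge0 ?sqr_ge0 ?ltW.
move=> t p v; rewrite /invariant_form.
pose m i j : R := tdiff mu p (i, j); pose b := a (graph mu t p).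
have aE : a (graph mu t p) (v, tdiff mu p v) =
    v.1 * (b (1, 0, 0) + m 1 0 * b (0, 0, 1))
  + v.2 * (b (0, 1, 0) + m 0 1 * b (0, 0, 1)).
  rewrite (linear_coord3 (a_linear _) (v, tdiff mu p v)) /=.
  rewrite (linear_coord2 (@tdiff_linear _ _ _ mu p) v) -/b -/(m 1 0) -/(m 0 1).
  move: (b (1, 0, 0)) (b (0, 1, 0)) (b (0, 0, 1)) (m 1 0) (m 0 1).
  move=> x1 x2 x3 m1 m2; ring.
have le1 : `|b (1, 0, 0) + m 1 0 * b (0, 0, 1)| <= K1.
  apply: (le_trans (ler_normD _ _)).
  by rewrite lerD ?hA1// normrM ler_pM ?hB1 ?hA3.
have le2 : `|b (0, 1, 0) + m 0 1 * b (0, 0, 1)| <= K2.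
  apply: (le_trans (ler_normD _ _)).
  by rewrite lerD ?hA2// normrM ler_pM ?hB2 ?hA3.
have a2 : a (graph mu t p) (v, tdiff mu p v) ^+ 2 <=
    2 * (K1 ^+ 2 + K2 ^+ 2) * (v.1 ^+ 2 + v.2 ^+ 2).
  by rewrite aE; exact: sqr_sum_bound.
have -> : 2 * (K1 ^+ 2 + K2 ^+ 2) * W * C * (v.1 ^+ 2 + v.2 ^+ 2) =
  2 * (K1 ^+ 2 + K2 ^+ 2) * (v.1 ^+ 2 + v.2 ^+ 2) * W * C by ring.
apply: ler_pM; [|by rewrite invr_ge0| |exact: hC].
  by rewrite mulr_ge0 ?sqr_ge0.
by apply: ler_pM; rewrite ?sqr_ge0.
Qed.

End Invariant.

(** * Vanishing of the form on the graphs *)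

Section Final.
Context {R : realType}.
Local Notation T2 := (torus2 R).
Local Notation T3 := (prod_lie (torus2 R) (circle R)).

Lemma is_tdiff_iter (M : lieGroup R) (k : M -> M) n p : tdifferentiable k ->
  is_diff (0 : tangent M) (local_expr (iter n.+1 k) p)
    (tdiff k (iter n k p) \o tdiff (iter n k) p).
Proof.
move=> dk; have iterS m : iter m.+1 k = k \o iter m k by apply/funext.
suff d m : differentiable (local_expr (iter m k) p) (0 : tangent M).
  by rewrite iterS; exact: tdiff_comp (d n) (dk _).
elim: m => [|m IH]; first by case: (local_expr_id_diff p).
by rewrite iterS; case: (tdiff_comp IH (dk _)).
Qed.

(** Invariance moves Q p v along the orbit, where it is at most K (C lambda^n |v|)^2, which tends to
    0. It serves for [f] on stable vectors and for its inverse on unstable ones. *)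
Lemma contracted_vanish (M : lieGroup R) g (k : M -> M) E C lambda K
    (Q : M -> tangent M -> R) p v :
  riemannian g -> tdifferentiable k -> 0 < lambda < 1 -> 0 < C -> 0 <= K ->
  contracted g k E C lambda ->
  (forall p v, Q (k p) (tdiff k p v) = Q p v) ->
  (forall p v, Q p v <= K * g p v v) ->
  E p v -> Q p v <= 0.
Proof.
move=> [lg gC gpos _] dk /andP[l0 l1] C0 K0 ctr Qinv Qbound Ev.
have Qn n : Q (iter n k p) (tdiff (iter n k) p v) = Q p v.
  elim: n => [|n IH]; first by rewrite (is_diff_tdiff (local_expr_id_diff p)).
  by rewrite (is_diff_tdiff (is_tdiff_iter n p dk)); exact: etrans (Qinv _ _) IH.
have g0 q u : 0 <= g q u u.
  have [->|u0] := eqVneq u 0; last exact/ltW/gpos.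
  have := lg q 0 1 0 0; rewrite !scale1r addr0 => /(congr1 (fun x => x - g q 0 0)).
  by rewrite subrr addrK => <-.
have normE q u : metric_norm g q u ^+ 2 = g q u u by rewrite sqr_sqrtr.
pose m := metric_norm g p v; pose c := K * (C * m) ^+ 2.
have le n : Q p v <= geometric c (lambda ^+ 2) n.
  rewrite -(Qn n); apply: (le_trans (Qbound _ _)); rewrite -normE.
  have -> : geometric c (lambda ^+ 2) n = K * (C * lambda ^+ n * m) ^+ 2.
    rewrite /geometric /= -exprM mulnC exprM /c.
    by move: (lambda ^+ n) => y; ring.
  apply: ler_wpM2l => //; apply: lerXn2r; rewrite ?nnegrE ?sqrtr_ge0//.
    by rewrite !mulr_ge0 ?exprn_ge0 ?sqrtr_ge0// ltW.
  exact: ctr.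
have cv : geometric c (lambda ^+ 2) @ \oo --> (0 : R).
  rewrite -[X in _ --> X](mulr0 c); apply: cvgM; first exact: cvg_cst.
  by apply: cvg_expr; rewrite normrX gtr0_norm// expr_lt1// ltW.
by apply: (cvgr_to_ge cv); exact: nearW.
Qed.

(** With b the value of [a] on the fibre direction, a = b (dt - dmu). As dmu is closed, da = db /\
    (dt - dmu), hence a /\ da = 0. *)
Lemma graph_form_not_contact (mu : T2 -> circle R) (a : T3 -> tangent T3 -> R) :
  tdifferentiable mu ->
  (forall v, differentiable_fun (fun p => tdiff mu p v : R)) ->
  contact_form a ->
  ~ (forall z v, a z (v, tdiff mu z.1 v) = 0).
Proof.
move=> dmu dmu2 a_contact a0.
have [[la sa] _] := a_contact.
have da v : differentiable_fun (fun z => a z v) by have [] := sa v 1%N.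
have /negP := contact_density_neq0 a_contact (0 : T3); apply.
pose m u p : R := tdiff mu p u.
(* The vector (u, 0) is the graph vector over u, killed by [a], minus dmu(u) times the fibre
   direction. *)
have aE u : (fun z => a z (u, 0)) = (fun z => - (m u z.1 * a z (0, 0, 1))).
  apply/funext => z; have := a0 z u.
  have -> : (u, tdiff mu z.1 u) = (m u z.1) *: (0, 0, 1) + (u, 0) :> R^o * R^o * R^o.
    case: u => u1 u2; congr (_, _, _); rewrite /= -![_ *: _]/(_ * _) ?mulr0 ?add0r//.
    by rewrite mulr1 addr0.
  by rewrite la => /eqP; rewrite addrC addr_eq0 => /eqP.
have dE u z y : fdiff (fun z => a z (u, 0)) z y =
    - (m u z.1 * fdiff (fun z => a z (0, 0, 1)) z y
       + a z (0, 0, 1) * fdiff (m u) z.1 y.1).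
  have d1 : is_tdiff (fun z : T3 => m u z.1) z (fun y => fdiff (m u) z.1 y.1).
    have [p1 e1] := local_expr_fst_diff z.
    have := @tdiff_comp _ _ _ (vector_lie R^o) _ (m u) z p1 (dmu2 u z.1).
    by rewrite (is_diff_tdiff (local_expr_fst_diff z)).
  have := is_tdiffN (is_tdiffM d1 (is_tdiff_fun z (da (0, 0, 1)))) => /fdiff_eq e.
  exact: etrans (congr1 (fun h => fdiff h z y) (aE u)) (congr1 (fun h => h y) e).
have aE' u z := congr1 (fun h => h z) (aE u).
(* This is the closedness of dmu at the point where the contradiction is reached. *)
have sym : fdiff (m (1, 0)) 0 (0, 1) = fdiff (m (0, 1)) 0 (1, 0).
  exact: tdiff_sym.
(* The base component of the fibre direction is 0, so dmu does not vary along it. *)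
have z0 u : fdiff (m u) (0 : T2) 0 = 0.
  rewrite (linear_coord2 (@tdiff_linear _ _ (vector_lie R^o) (m u) 0) 0).
  by rewrite !mul0r addr0.
rewrite /contact_density /wedge_ext_deriv /ext_deriv /= !dE !aE' /= sym !z0.
move: (m _ _) (m _ _) (a _ _) (fdiff (fun z => a z (0, 0, 1)) _ _)
 (fdiff (fun z => a z (0, 0, 1)) _ _) (fdiff (fun z => a z (0, 0, 1)) _ _)
 (fdiff (m _) _ _).
move=> *; apply/eqP; ring.
Qed.

Lemma diffeo_tdiffK (M : lieGroup R) (f finv : M -> M) p v :
  cancel finv f -> tdifferentiable f -> tdifferentiable finv ->
  tdiff f (finv p) (tdiff finv p v) = v.
Proof.
move=> fK df dfinv.
have e : f \o finv = id by apply/funext.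
have := is_diff_tdiff (tdiff_comp (dfinv p) (df (finv p))).
move=> /(congr1 (fun h => h v)) /= <-.
by rewrite e (is_diff_tdiff (local_expr_id_diff p)).
Qed.

End Final.

Local Close Scope ring_scope.

Theorem theorem3p1 (R : realType) (l r : regularity)
    (f : torus2 R -> torus2 R) (gamma : torus2 R -> circle R) :
  reg_le (Some 2) l -> reg_le l r ->
  anosov r f -> conservative f ->
  class_C r gamma -> coboundary l f gamma ->
  ~ partially_hyperbolic_contact r (skew_product f gamma).
Proof.
move=> l2 lr [finv [fK finvK f_C finv_C]] [g gP] [Es [Eu [_ split_E _]]].
move=> [C [lambda [C0 lambda01 ctr_s ctr_u]]] [w wP f_area] _ [mu mu_C gammaE].
move=> [[Finv [_ _ F_C _] _] [a a_contact [tau [tau_smooth tau_gt0 pullF]]]].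
have r2 : reg_le (Some 2) r.
  by case: (l) (r) l2 lr => [l'|] [r'|] //=; apply: leq_trans.
have [f_diff _] := class_C_Cn r2 f_C.
have [finv_diff _] := class_C_Cn r2 finv_C.
have [F_diff F_C1] := class_C_Cn r2 F_C.
have F_diff2 v := (F_C1 v).1.
have [mu_diff mu_C1] := class_C_Cn l2 mu_C.
have mu_diff2 v := (mu_C1 v).1.
have tau_diff := (tau_smooth 1%N).1.
pose Q t p v := invariant_form mu a w t p v.
have Qf t p v : Q t (f p) (tdiff f p v) = Q t p v.
  exact: (invariant_formE f_diff F_diff F_diff2 mu_diff gammaE a_contact
    tau_diff tau_gt0 pullF wP f_area).
have Qfinv t p v : Q t (finv p) (tdiff finv p v) = Q t p v.
  by rewrite -Qf finvK (diffeo_tdiffK _ _ finvK f_diff finv_diff).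
have [K K0 QK] := invariant_form_bound mu_diff2 a_contact wP.
have [k k0 gk] := riemannian_lower_bound gP.
(* [K] compares [Q] with the Euclidean norm, and [k] compares that norm with the metric [g] of the
   Anosov splitting. *)
have Qg t p v : (Q t p v <= K * k * g p v v)%R.
  by apply: (le_trans (QK t p v)); rewrite -mulrA ler_wpM2l.
have Kk0 : (0 <= K * k)%R by rewrite mulr_ge0// ltW.
(* [Q] is a square times positive densities, so it can be nonpositive only where the square
   vanishes. *)
have Q0 t p v : (Q t p v <= 0)%R -> a (graph mu t p) (v, tdiff mu p v) = 0%R.
  rewrite /Q /invariant_form pmulr_lle0; last first.
    by rewrite invr_gt0 normr_gt0 contact_density_neq0.
  rewrite pmulr_lle0; last by rewrite normr_gt0 area_form_neq0.
  by rewrite real_exprn_even_le0 ?num_real//= => /eqP.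
apply: (@graph_form_not_contact R mu a mu_diff mu_diff2 a_contact) => z v.
(* The graphs fill the 3-torus, and this choice of [t] selects the one through [z]. *)
have -> : z = graph mu (z.2 - mu z.1) z.1 by case: z => p s; rewrite /graph subrK.
set t := (z.2 - _)%R.
have [[u u'] [[us uu /= ->] _]] := split_E z.1 v.
have [[la _] _] := a_contact.
have as0 := Q0 t _ _
  (contracted_vanish gP f_diff lambda01 C0 Kk0 ctr_s (Qf t) (Qg t) us).
have au0 := Q0 t _ _
  (contracted_vanish gP finv_diff lambda01 C0 Kk0 ctr_u (Qfinv t) (Qg t) uu).
(* Linearity of dmu splits the graph vector over [u + u'] into the stable and unstable ones, both
   killed by [a]. *)
have muD := tdiff_linear mu z.1 1%R u u'.
rewrite !scale1r in muD.
have := la (graph mu t z.1) 1%R (u, tdiff mu z.1 u) (u', tdiff mu z.1 u').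
by rewrite scale1r as0 au0 scaler0 addr0 /= muD.
Qed.
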